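(* Let $(X,T)$ be a topological space and let $({}^*X,{}^sT)$ be its nonstandard compactification. Then: (i) Every internal subset $\mathcal A$ of ${}^*X$ is compact in $({}^*X,{}^sT)$. (ii) $({}^*X,{}^sT)$ is a compact topological space and $(X,T)$ is a dense subspace of $({}^*X,{}^sT)$.
   Context: Nonstandard setting. Let $S\supseteq X\cup\mathbb R$ be a set of individuals, with superstructure $V(S)=\bigcup_{k\ge 0}V_k(S)$, $V_0(S)=S$, $V_{k+1}(S)=V_k(S)\cup\mathcal P(V_k(S))$. A $\kappa$-saturated nonstandard model of $S$ is a superstructure $V({}^*S)$ with a map $A\mapsto {}^*A$ from $V(S)$ into $V({}^*S)$ satisfying: (Extension) ${}^*s=s$ for all $s\in S$; (Transfer) a bounded quantifier formula $\Phi(A_1,\dots,A_n)$ with constants in $V(S)$ is true iff $\Phi({}^*A_1,\dots,{}^*A_n)$ is true in $V({}^*S)$; (Saturation) every family of at most $\kappa$ internal sets with the finite intersection property has nonempty intersection. An entity of $V({}^*S)$ is internal if it is an element of ${}^*A$ for some $A\in V(S)$. Throughout, a $\kappa$-saturated model with $\kappa$ infinite and $\kappa>\operatorname{card}T$ is fixed; $X\subseteq {}^*X$ via the Extension principle. The standard topology ${}^sT$ on ${}^*X$ is the topology with base $\{{}^*G: G\in T\}$. The space $({}^*X,{}^sT)$ is called the nonstandard compactification of $(X,T)$. ''Compact'' means every open cover has a finite subcover (no Hausdorff requirement). *)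

(* Defs.v *)
From HB Require Import structures.
From mathcomp Require Import all_boot all_order all_algebra.
From mathcomp Require Import all_classical all_reals all_analysis.

Set Implicit Arguments.
Unset Strict Implicit.
Unset Printing Implicit Defensive.

Local Open Scope classical_set_scope.
Local Open Scope card_scope.

Section Stages.
Context (S V : Type) (ind : S -> V) (mem : V -> V -> Prop).

Definition is_set_of (x : V) := forall s, x <> ind s.

(* V_0 = S and V_{k+1} = V_k `|` P(V_k) *)
Fixpoint stage_of (k : nat) : set V :=
  if k is k'.+1 then
    stage_of k' `|`
      [set x | is_set_of x /\ forall y, mem y x -> stage_of k' y]
  else range ind.

End Stages.

(* The superstructure V(S) over a set S of individuals, given by its carrier,
   the inclusion of the individuals and the membership relation.  Individuals
   are not sets and have no elements.  The last two fields say that V(S) is the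
   union of the V_k(S) and that P(V_k(S)) is the full power set; the fields
   determine V(S) up to a unique isomorphism over S, and such a structure exists
   for every S (lemma superstructure_exists). *)
Record superstructure (S : Type) := Superstructure {
  entity :> Type;
  individual : S -> entity;
  mem : entity -> entity -> Prop;
  individual_inj : injective individual;
  mem_individual : forall x s, ~ mem x (individual s);
  mem_ext : forall A B, is_set_of individual A -> is_set_of individual B ->
    (forall x, mem x A <-> mem x B) -> A = B;
  stage_total : forall x, exists k, stage_of individual mem k x;
  stage_power : forall k (P : set entity), P `<=` stage_of individual mem k ->
    exists A, is_set_of individual A /\ forall x, mem x A <-> P x
}.

Section SuperstructureTheory.
Context (S : Type) (V : superstructure S).

Definition is_set (x : V) := is_set_of (@individual S V) x.

Lemma set_of_ind_subproof (P : set S) : exists A : V,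
  is_set A /\ forall x, mem x A <-> (@individual S V @` P) x.
Proof. by apply: (@stage_power S V 0) => x [s Ps <-]; exists s. Qed.

(* The set P of individuals as an entity of V(S). *)
Definition set_of_ind (P : set S) : V := sval (cid (set_of_ind_subproof P)).

Lemma mem_set_of_ind (P : set S) x :
  mem x (set_of_ind P) <-> (@individual S V @` P) x.
Proof. by rewrite /set_of_ind; case: cid => A [? HA]; exact: HA. Qed.

Lemma mem_set_of_indE (P : set S) s :
  mem (individual V s) (set_of_ind P) <-> P s.
Proof.
rewrite mem_set_of_ind; split=> [[t Pt ts]|Ps]; last by exists s.
by rewrite -(individual_inj ts).
Qed.

Lemma is_set_set_of_ind (P : set S) : is_set (set_of_ind P).
Proof. by rewrite /set_of_ind; case: cid => A [? ?]. Qed.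

End SuperstructureTheory.

(* Bounded quantifier formulas: x, y range over variables named by nat, and
   BAll x y p, BEx x y p stand for (forall x \in y, p), (exists x \in y, p). *)
Inductive bqf : Type :=
  | BMem of nat & nat
  | BEq of nat & nat
  | BNot of bqf
  | BAnd of bqf & bqf
  | BOr of bqf & bqf
  | BImp of bqf & bqf
  | BAll of nat & nat & bqf
  | BEx of nat & nat & bqf.

Definition update (V : Type) (e : nat -> V) (x : nat) (a : V) : nat -> V :=
  fun z => if z == x then a else e z.

(* The assignment e supplies the constants A_1, ..., A_n substituted for the
   (finitely many) free variables of the formula. *)
Fixpoint holds (S : Type) (V : superstructure S) (p : bqf) (e : nat -> V)
    : Prop :=
  match p with
  | BMem x y => mem (e x) (e y)
  | BEq x y => e x = e y
  | BNot p => ~ holds p e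
  | BAnd p q => holds p e /\ holds q e
  | BOr p q => holds p e \/ holds q e
  | BImp p q => holds p e -> holds q e
  | BAll x y p => forall a, mem a (e y) -> holds p (update e x a)
  | BEx x y p => exists a, mem a (e y) /\ holds p (update e x a)
  end.

Definition internal_for (S S' : Type) (V : superstructure S)
    (V' : superstructure S') (star : V -> V') (a : V') :=
  exists A : V, mem a (star A).

(* A kappa-saturated nonstandard model of S, where kappa is the cardinal of K.
   The inclusion of S in *S is an injection of types, and the set *S of
   individuals is the image under star of the entity S. *)
Record nonstandard_model (K S : Type) := NonstandardModel {
  std : superstructure S;
  starS : Type;
  nonstd : superstructure starS;
  S_sub : {inj [set: S] >-> starS};
  star : std -> nonstd;
  star_setT : star (set_of_ind std setT) = set_of_ind nonstd setT;
  extension : forall s, star (individual std s) = individual nonstd (S_sub s);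
  transfer : forall (p : bqf) (e : nat -> std),
    holds p e <-> holds p (star \o e);
  saturation : forall F : set nonstd,
    (forall A, F A -> is_set A /\ internal_for star A) ->
    F #<= [set: K] ->
    (forall G, finite_set G -> G `<=` F ->
      exists v, forall A, G A -> mem v A) ->
    exists v, forall A, F A -> mem v A
}.

Section NonstandardCompactification.
Context (K S : Type) (M : nonstandard_model K S).

Definition internal (a : nonstd M) := internal_for (@star K S M) a.

Definition star_set (P : set S) : nonstd M := star (set_of_ind (std M) P).

Lemma star_setI (P Q : set S) v :
  mem v (star_set (P `&` Q)) <-> mem v (star_set P) /\ mem v (star_set Q).
Proof.
pose e z := match z with
  | 0%N => set_of_ind (std M) P
  | 1%N => set_of_ind (std M) Q
  | _ => set_of_ind (std M) (P `&` Q) end.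
pose p := BAnd (BAll 3 2 (BAnd (BMem 3 0) (BMem 3 1)))
  (BAll 3 0 (BImp (BMem 3 1) (BMem 3 2))).
have /transfer : holds p e.
  rewrite /= /update /=; split=> a /mem_set_of_ind [s].
    by move=> [Ps Qs] <-; rewrite !mem_set_of_indE.
  by move=> Ps <-; rewrite !mem_set_of_indE.
rewrite /= /update /= => -[H1 H2]; split; first exact: H1.
by move=> [? ?]; exact: H2.
Qed.

Lemma star_set_individual (P : set S) s :
  P s -> mem (individual (nonstd M) (S_sub M s)) (star_set P).
Proof.
move=> Ps; pose e z := if z is 0%N then individual (std M) s
  else set_of_ind (std M) P.
have /transfer : holds (BMem 0 1) e by exact/mem_set_of_indE.
by rewrite /= extension.
Qed.

Context (X : topologicalType) (X_sub : {inj [set: X] >-> S}).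

(* *X, where X is identified with the subset range X_sub of S *)
Definition nscompact : Type :=
  {v : nonstd M | mem v (star_set (range X_sub))}.

HB.instance Definition _ := gen_eqMixin nscompact.
HB.instance Definition _ := gen_choiceMixin nscompact.

(* *G as a subset of *X *)
Definition star_sub (G : set X) : set nscompact :=
  [set y | mem (sval y) (star_set (X_sub @` G))].

Lemma star_sub_cover : \bigcup_(G in (open : set (set X))) star_sub G = setT.
Proof. by rewrite -subTset => y _; exists setT; [exact: openT|exact: (svalP y)]. Qed.

Lemma star_sub_join (G H : set X) (y : nscompact) : open G -> open H ->
  star_sub G y -> star_sub H y ->
  exists L, [/\ open L, star_sub L y & star_sub L `<=` star_sub G `&` star_sub H].
Proof.
move=> oG oH Gy Hy; have E : X_sub @` (G `&` H) = X_sub @` G `&` X_sub @` H.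
  rewrite eqEsubset; split=> [_ [x [Gx Hx] <-]|]; first by split; exists x.
  move=> w [[x Gx xw] [z Hz zw]]; exists x => //; split=> //.
  by rewrite -(@injT _ _ X_sub z x) // zw.
exists (G `&` H); rewrite /star_sub E /=; split; first exact: openI.
  exact/star_setI.
by move=> z /= /star_setI.
Qed.

(* the standard topology, with base {*G | G open in X} *)
HB.instance Definition _ :=
  isBaseTopological.Build nscompact star_sub_cover star_sub_join.

Lemma nscompact_openE (U : set nscompact) : open U <->
  exists2 D : set (set X), D `<=` open & \bigcup_(G in D) star_sub G = U.
Proof. by []. Qed.

(* the inclusion of X in *X: the point x of X is *x = x *)
Definition nsinj (x : X) : nscompact :=
  exist _ (individual (nonstd M) (S_sub M (X_sub x)))
    (star_set_individual (imageP X_sub I : range X_sub (X_sub x))).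

Definition internal_subset (A : set nscompact) :=
  exists a : nonstd M, [/\ internal a, is_set a &
    forall v, mem v a <-> exists2 y, A y & sval y = v].

End NonstandardCompactification.

Definition card_lt (T U : Type) (A : set T) (B : set U) :=
  A #<= B /\ ~ (B #<= A).

Section SuperstructureExists.
Context (S : Type).

(* Level k consists of the individuals and the sets of members of level k-1;
   the superstructure is the union of the levels modulo extensional equality. *)
Fixpoint level (k : nat) : Type :=
  if k is k'.+1 then (S + set (level k'))%type else S.

Fixpoint leq_ext k j : level k -> level j -> Prop :=
  match k, j with
  | 0, 0 => fun s t => s = t
  | 0, _.+1 => fun s y => if y is inl t then s = t else False
  | _.+1, 0 => fun x t => if x is inl s then s = t else False
  | k'.+1, j'.+1 => fun x y =>
      match x, y with
      | inl s, inl t => s = t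
      | inr A, inr B =>
          (forall a, A a -> exists2 b, B b & leq_ext a b) /\
          (forall b, B b -> exists2 a, A a & leq_ext a b)
      | _, _ => False
      end
  end.

Let pre := {k & level k}.
Let eqv (x y : pre) := leq_ext (projT2 x) (projT2 y).

Lemma leq_ext_refl k (x : level k) : leq_ext x x.
Proof.
elim: k x => [//|k IH] [//|A] /=.
by split=> a Aa; exists a.
Qed.

Lemma leq_ext_sym k j (x : level k) (y : level j) : leq_ext x y -> leq_ext y x.
Proof.
elim: k j x y => [|k IH] [|j] //=; first by move=> x [].
  by move=> [].
move=> [s|A] [t|B] //= [AB BA]; split=> a.
  by move=> /BA[b Ab ?]; exists b => //; exact: IH.
by move=> /AB[b Ab ?]; exists b => //; exact: IH.
Qed.

Lemma leq_ext_trans k j i (x : level k) (y : level j) (z : level i) :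
  leq_ext x y -> leq_ext y z -> leq_ext x z.
Proof.
elim: k j i x y z => [|k IH] [|j] [|i] /=;
  try by (move=> ? ? ? -> //) || by move=> ? ? [] ? // -> .
- by move=> x [t|//] z -> .
- by move=> x [t|//] [u|//] -> .
- by move=> [s|//] t u -> .
- by move=> [s|//] t [u|//] -> .
- by move=> [s|A] [t|B] z // -> .
move=> [s|A] [t|B] [u|C] //= => [-> //|[AB BA] [BC CB]]; split.
  by move=> a /AB[b /BC[c Cc bc] ab]; exists c => //; exact: IH bc.
by move=> c /CB[b /BA[a Aa ab] bc]; exists a => //; exact: IH bc.
Qed.

Let V := {C : set pre | exists x, C = eqv x}.
Let cls (x : pre) : V := exist _ (eqv x) (ex_intro _ x erefl).

Let clsP (v : V) : exists x, v = cls x.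
Proof. by case: v => C [x Cx]; exists x; apply: eq_exist. Qed.

Let cls_eq x y : cls x = cls y <-> eqv x y.
Proof.
split=> [[/(congr1 (@^~ y)) ->]|xy]; first exact: leq_ext_refl.
apply: eq_exist; apply/funext => z; apply/propext; split.
  by apply: leq_ext_trans; exact: leq_ext_sym.
exact: leq_ext_trans.
Qed.

Let lev k (x : level k) : pre := existT _ k x.
Let ind (s : S) : V := cls (lev (k := 0) s).
Let vmem (v w : V) : Prop :=
  exists k (A : set (level k)) a,
    [/\ w = cls (lev (k := k.+1) (inr A)), A a & v = cls (lev a)].

Let vmemE v k (A : set (level k)) :
  vmem v (cls (lev (k := k.+1) (inr A))) <-> exists2 a, A a & v = cls (lev a).
Proof.
split=> [[j [B [b [/cls_eq [AB BA] Bb ->]]]]|[a Aa ->]]; last by exists k, A, a.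
by have [a Aa ab] := BA _ Bb; exists a => //; apply/cls_eq/leq_ext_sym.
Qed.

Let inlE k s : cls (lev (k := k.+1) (inl s)) = ind s.
Proof. exact/cls_eq. Qed.

Let inr_is_set k (A : set (level k)) :
  is_set_of ind (cls (lev (k := k.+1) (inr A))).
Proof. by move=> s /cls_eq. Qed.

Let is_setP v : is_set_of ind v ->
  exists k (A : set (level k)), v = cls (lev (k := k.+1) (inr A)).
Proof.
have [[[|k] x] ->] := clsP v; first by move=> /(_ x).
by case: x => [s /(_ s)|A _]; [rewrite inlE|exists k, A].
Qed.

Let vmem_ext A B : is_set_of ind A -> is_set_of ind B ->
  (forall x, vmem x A <-> vmem x B) -> A = B.
Proof.
move=> /is_setP[k [P ->]] /is_setP[j [Q ->]] PQ; apply/cls_eq; split.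
  move=> a Pa; have /PQ/vmemE[b Qb /cls_eq ab] :
    vmem (cls (lev a)) (cls (lev (k := k.+1) (inr P))) by apply/vmemE; exists a.
  by exists b.
move=> b Qb; have /PQ/vmemE[a Pa /cls_eq ba] :
  vmem (cls (lev b)) (cls (lev (k := j.+1) (inr Q))) by apply/vmemE; exists b.
by exists a => //; exact: leq_ext_sym.
Qed.

Let up k (x : level k) : exists y : level k.+1, leq_ext x y.
Proof.
elim: k x => [|k IH] x; first by exists (inl x).
case: x => [s|A]; first by exists (inl s).
exists (inr [set b : level k.+1 | exists2 a : level k, A a & leq_ext a b]
  : level k.+2).
split=> [|b [a Aa ab]]; last by exists a.
by move=> a Aa; have [b ab] := IH a; exists b => //; exists a.
Qed.

Let stageP k v : stage_of ind vmem k v <-> exists x : level k, v = cls (lev x).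
Proof.
elim: k v => [|k IH] v /=.
  by split=> [[s _ <-]|[s ->]]; exists s.
split=> [[/IH[x ->]|[vset vk]]|[[s|A] ->]].
- by have [y xy] := up x; exists y; apply/cls_eq.
- exists (inr [set a | vmem (cls (lev a)) v]).
  apply: (vmem_ext vset (@inr_is_set _ _)) => x.
  rewrite vmemE; split=> [xv|[a /= av ->]//].
  by have /IH[a ax] := vk _ xv; exists a => //=; rewrite -ax.
- left; elim: k {IH} => [|k IH]; rewrite inlE /=; first by exists s.
  by left; rewrite -(inlE k).
- right; split=> [|y /vmemE[a _ ->]]; first exact: inr_is_set.
  by apply/IH; exists a.
Qed.

Lemma superstructure_exists : inhabited (superstructure S).
Proof.
constructor; apply: (@Superstructure S V ind vmem).
- by move=> s t /cls_eq.
- by move=> x s [k [A [a [/cls_eq]]]].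
- exact: vmem_ext.
- by move=> v; have [[k x] ->] := clsP v; exists k; apply/stageP; exists x.
- move=> k P Pk; exists (cls (lev (k := k.+1) (inr [set a | P (cls (lev a))]))).
  split=> [|x]; first exact: inr_is_set.
  rewrite vmemE; split=> [[a Pa ->]//|Px].
  by have /stageP[a xa] := Pk _ Px; exists a => //=; rewrite -xa.
Qed.

End SuperstructureExists.

(* Main.v *)
(* If an internal set A, represented by the entity a, had no finite subcover,
   the internal sets a \ *G, for G open with *G contained in a member of the
   cover, would have the finite intersection property; there are at most
   card T <= kappa of them, so saturation yields a point of A lying in no such
   *G, hence in no member of the cover.  Note that *X is itself internal. *)
Require Import Defs.
From HB Require Import structures.
From mathcomp Require Import all_boot all_order all_algebra.
From mathcomp Require Import all_classical all_reals all_analysis.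

Local Open Scope classical_set_scope.

(* [ssrbool] shadows the membership relation of superstructures. *)
Local Notation mem := Defs.mem.

(** Individuals have no elements, so every stage is transitive; this lets [stage_power] form sets
    out of elements of a given set. *)
Lemma stage_trans {S : Type} {V : superstructure S} {k} {x y : V} :
  mem y x -> stage_of (@individual S V) (@mem S V) k x ->
  stage_of (@individual S V) (@mem S V) k y.
Proof.
elim: k x y => [|k IH] x y yx /=.
  by move=> [s _ sx]; case: (@mem_individual _ V y s); rewrite sx.
by move=> [xk|[_ xk]]; left; [exact: IH yx xk|exact: xk].
Qed.

(** Turns being a set into a bounded formula with the set of individuals as a constant, so that
    transfer applies to it. *)
Lemma is_set_notin_ind {S : Type} {V : superstructure S} (x : V) :
  is_set x <-> ~ mem x (set_of_ind V setT).
Proof.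
rewrite mem_set_of_ind; split=> [xset [s _ sx]|xT s xs].
  exact: (xset s).
by apply: xT; exists s.
Qed.

Section Star.
Context {K S : Type} (M : nonstandard_model K S).

Lemma star_mem (x y : std M) : mem x y <-> mem (star x) (star y).
Proof.
pose e z := if z is 0%N then x else y.
exact: (transfer (BMem 0 1) e).
Qed.

Lemma is_set_nonstd (x : nonstd M) : is_set x <-> ~ mem x (star_set M setT).
Proof. by rewrite /star_set star_setT; exact: is_set_notin_ind. Qed.

Lemma is_set_star_set (P : set S) : is_set (star_set M P).
Proof.
apply/is_set_nonstd => /star_mem.
by apply/is_set_notin_ind; exact: is_set_set_of_ind.
Qed.

(** The singleton of [P] is an entity of V(S), and by transfer its star contains *P. *)
Lemma internal_star_set (P : set S) : internal (star_set M P).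
Proof.
have [k Pk] := stage_total (set_of_ind (std M) P).
have [C [_ CE]] : exists C : std M, is_set C /\
    forall x, mem x C <-> x = set_of_ind (std M) P.
  by apply: (@stage_power _ _ k) => x ->.
by exists C; apply/star_mem/CE.
Qed.

Lemma star_set_individualE (P : set S) s :
  mem (individual (nonstd M) (S_sub M s)) (star_set M P) <-> P s.
Proof. by rewrite -extension -star_mem mem_set_of_indE. Qed.

Lemma star_set0 v : ~ mem v (star_set M set0).
Proof.
pose e (z : nat) := set_of_ind (std M) set0.
(* [BNot (BEq 1 1)] is always false, so the formula says that variable 0 has no elements. *)
have /transfer : holds (BAll 1 0 (BNot (BEq 1 1))) e.
  by move=> a /mem_set_of_ind[].
by move=> H /(H v); exact.
Qed.

(* The differences y \ P, for y in C, form an entity of V(S); by transfer its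
   image under star consists of the differences a \ *P, for a in *C. *)
Lemma internal_diff (a : nonstd M) (P : set S) : internal a ->
  exists b : nonstd M, [/\ internal b, is_set b &
    forall v, mem v b <-> mem v a /\ ~ mem v (star_set M P)].
Proof.
move=> [C aC].
pose isdiff (y b : std M) := is_set b /\
  forall v, mem v b <-> mem v y /\ ~ mem v (set_of_ind (std M) P).
have [k Ck] := stage_total C.
have [E [_ EE]] : exists E : std M, is_set E /\
    forall b, mem b E <-> exists2 y, mem y C & isdiff y b.
  (* The elements of [y \ P] lie in stage [k] by transitivity, so the difference itself lies in
     stage [k.+1]. *)
  apply: (@stage_power _ _ k.+1) => b [y yC [bset bE]] /=; right.
  split=> // v /bE[vy _]; exact: stage_trans vy (stage_trans yC Ck).
pose e z := match z with
  | 0%N => C | 1%N => E | 2%N => set_of_ind (std M) P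
  | _ => set_of_ind (std M) setT end.
(* Variables 4, 5 and 6 stand for [y], its difference from [P], and an element; [BNot (BMem 5 3)]
   says that the difference is a set. *)
pose p := BAll 4 0 (BEx 5 1 (BAnd (BNot (BMem 5 3))
  (BAnd (BAll 6 5 (BAnd (BMem 6 4) (BNot (BMem 6 2))))
    (BAll 6 4 (BImp (BNot (BMem 6 2)) (BMem 6 5)))))).
have /transfer : holds p e.
  rewrite /= /update /= => y yC.
  have [k' yk] := stage_total y.
  have [b [bset bE]] : exists b : std M, is_set b /\
      forall v, mem v b <-> mem v y /\ ~ mem v (set_of_ind (std M) P).
    by apply: (@stage_power _ _ k') => v [vy _]; exact: stage_trans vy yk.
  exists b; split; first by apply/EE; exists y.
  split; first exact/is_set_notin_ind.
  by split=> v; [move=> /bE|move=> vy vP; apply/bE].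
rewrite /= /update /= => /(_ a aC)[b [bE [bT [ba ab]]]].
exists b; split; first by exists E.
  exact/is_set_nonstd.
by move=> v; split=> [/ba//|[]]; exact: ab.
Qed.

End Star.

Section Compactification.
Context {K S : Type} (M : nonstandard_model K S).
Context {X : topologicalType} (X_sub : {inj [set: X] >-> S}).

Lemma nsinj_inj : injective (@nsinj K S M X X_sub).
Proof.
by move=> x y /(congr1 sval) xy; exact: injT (injT (individual_inj xy)).
Qed.

(** By transfer a point of X lies in *G exactly when it lies in G; this is why the topology induced
    on X is the original one. *)
Lemma preimage_star_sub (G : set X) :
  nsinj M X_sub @^-1` star_sub (M := M) (X_sub := X_sub) G = G.
Proof.
apply/seteqP; split=> [x /star_set_individualE[y Gy yx]|x Gx].
  by rewrite -(@injT _ _ X_sub _ _ yx).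
by apply/star_set_individualE; exists x.
Qed.

Lemma open_star_sub (G : set X) : open G ->
  open (star_sub (M := M) (X_sub := X_sub) G).
Proof.
move=> oG; apply/nscompact_openE.
by exists [set G]; [move=> _ ->|exact: bigcup_set1].
Qed.

Lemma open_star_subP {U : set (nscompact M X_sub)} {y} : open U -> U y ->
  exists G : set X, [/\ open G, star_sub G y & star_sub G `<=` U].
Proof.
move=> /nscompact_openE[D Dopen <-] [G DG Gy].
by exists G; split=> //; [exact: Dopen|exact: bigcup_sup].
Qed.

Lemma nsinj_openE (G : set X) : open G <->
  exists2 U : set (nscompact M X_sub), open U & G = nsinj M X_sub @^-1` U.
Proof.
split=> [oG|[U /nscompact_openE[D Dopen <-] ->]].
  by exists (star_sub G); [exact: open_star_sub|rewrite preimage_star_sub].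
rewrite preimage_bigcup; apply: bigcup_open => H DH.
by rewrite preimage_star_sub; exact: Dopen.
Qed.

(** A nonempty open set contains a nonempty *G; since the star of the empty set is empty, G has a
    point, and it lies in *G. *)
Lemma dense_nsinj : dense (range (nsinj M X_sub)).
Proof.
move=> U [y Uy] oU; have [G [_ Gy GU]] := open_star_subP oU Uy.
have [x Gx] : G !=set0.
  apply/set0P/eqP => G0; move: Gy; rewrite /star_sub /= G0 image_set0.
  exact: star_set0.
exists (nsinj M X_sub x); split; last by exists x.
by apply: GU; move: Gx; rewrite -{1}[G]preimage_star_sub.
Qed.

Lemma internal_subsetT : internal_subset [set: nscompact M X_sub].
Proof.
exists (star_set M (range X_sub)); split=> [||v].
- exact: internal_star_set.
- exact: is_set_star_set.
- by split=> [vX|[y _ <-]]; [exists (exist _ v vX)|exact: (svalP y)].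
Qed.

Lemma internal_cover_compact (A : set (nscompact M X_sub)) :
  ((open : set (set X)) #<= [set: K])%card -> internal_subset A ->
  cover_compact A.
Proof.
move=> card_T [a [aint _ aE]] I D f fopen Acover.
have [[y0 Ay0]|A0] := pselect (A !=set0); last first.
  by exists (finmap.fset0) => // y Ay; case: A0; exists y.
have [i0 _ _] := Acover _ Ay0.
have [d dP] := choice (fun G : set X => internal_diff M a (X_sub @` G) aint).
(* Indexing by open sets of X bounds the family by card T, whereas [D] may be arbitrarily large. *)
pose B := [set G : set X | open G /\ exists2 i, D i & star_sub G `<=` f i].
(* A difference gets an index whose cover member contains the removed *G; [i0] is the default for
   any other [b]. *)
have dB b : exists i, (d @` B) b ->
    D i /\ forall y, A y -> ~ f i y -> mem (sval y) b.
  have [[G [_ [i Di Gi]] <-]|nb] := pselect ((d @` B) b); last by exists i0.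
  exists i => _; split=> // y Ay fiy; have [_ _ dE] := dP G.
  by apply/dE; split=> [|/Gi//]; apply/aE; exists y.
have [h hP] := choice dB.
apply: contrapT => nofin.
have [] := @saturation K S M (d @` B).
- by move=> _ [G _ <-]; have [] := dP G.
- apply: card_le_trans card_T; apply: card_le_trans (card_image_le _ _) _.
  by apply: subset_card_le => G [].
- move=> F Ffin FB; apply: contrapT => Fv; apply: nofin.
  (* The indices chosen for a finite subfamily without a common point would give a finite
     subcover. *)
  have /finite_fsetP[D' D'E] := finite_image h Ffin.
  exists D' => [i iD'|y Ay].
    have [b Fb <-] : (h @` F) i by rewrite D'E.
    by rewrite inE; have [] := hP _ (FB _ Fb).
  apply: contrapT => yD'; apply: Fv; exists (sval y) => b Fb.
  have [_] := hP _ (FB _ Fb); apply=> // fy; apply: yD'; exists (h b) => //.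
  by rewrite -D'E; exists b.
move=> v vB.
have vdB G : B G -> mem v a /\ ~ mem v (star_set M (X_sub @` G)).
  by move=> BG; have [_ _ dE] := dP G; apply/dE/vB; exists G.
(* The point [y0] provides a member of the family, which puts [v] in [a]. *)
have [i Di fy0] := Acover _ Ay0.
have [G [oG _ Gf]] := open_star_subP (fopen _ Di) fy0.
have [/aE[y Ay yv] _] : mem v a /\ ~ mem v (star_set M (X_sub @` G)).
  by apply: vdB; split=> //; exists i.
have [j Dj fy] := Acover _ Ay.
have [H [oH Hy Hf]] := open_star_subP (fopen _ Dj) fy.
have [|_] := vdB H; first by split=> //; exists j.
by rewrite -yv; exact.
Qed.

End Compactification.

Theorem mainTheorem1 (R : realType) (X : topologicalType) (S K : Type)
    (X_sub : {inj [set: X] >-> S}) (R_sub : {inj [set: R] >-> S})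
    (M : nonstandard_model K S)
    (K_infinite : infinite_set [set: K])
    (card_T : card_lt (open : set (set X)) [set: K]) :
  (forall A : set (nscompact M X_sub), internal_subset A -> cover_compact A) /\
  (cover_compact [set: nscompact M X_sub] /\
   [/\ injective (@nsinj K S M X X_sub),
       forall G : set X, open G <->
         exists2 U : set (nscompact M X_sub), open U & G = nsinj M X_sub @^-1` U &
       dense (range (nsinj M X_sub))]).
Proof.
have cpt (A : set (nscompact M X_sub)) : internal_subset A -> cover_compact A.
  by case: card_T => cT _; exact: internal_cover_compact cT.
split=> //; split; first exact/cpt/internal_subsetT.
by split; [exact: nsinj_inj|exact: nsinj_openE|exact: dense_nsinj].
Qed.
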